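(* Let $X_t$ be a Lévy process of type $I_c$ with $\gamma=\int_{|y|<1}y\,\nu(dy)$, and suppose that $\|T\|<\Omega$. Then the operator $L_\Delta^{-1}$ exists and has the form $$L_\Delta^{-1}=-B=-\frac1\Omega(I+T_1),$$ where the operator $T_1$ acts in the space $D_\Delta$, is bounded, and is defined by a formula $$T_1f(x)=\int_\Delta f(y)\,d_y\Phi(x,y),$$ in which the function $\Phi(x,y)$ is continuous with respect to $x$ and with respect to $y$, and monotonically increasing (non-decreasing) with respect to $y$.
   Context: A Lévy process with triplet $(A,\gamma,\nu)$ (so $E e^{izX_t}=e^{-t\lambda(z)}$, $\lambda(z)=\frac12Az^2-i\gamma z-\int(e^{ixz}-1-ixz1_{|x|<1})\nu(dx)$) is of type $I_c$ if $A=0$ and $\nu$ is finite (summable) and continuous (no atoms). $\Omega=\nu(\mathbb R)$. $\Delta=\bigcup_{k=1}^n[a_k,b_k]$ with $a_1<b_1<\dots<a_n<b_n$; $D_\Delta$ is the Banach space of continuous functions on $\Delta$ with the sup norm. On $D_\Delta$, $Tf(x)=\int_\Delta f(y)\,d_y\nu(y-x)=\int_{\{u:\,x+u\in\Delta\}}f(x+u)\,\nu(du)$, and the truncated generator is $L_\Delta f=-\Omega f+Tf$. An operator $B$ on $D_\Delta$ is called a quasi-potential if $-BL_\Delta g=g$ for all $g\in D_\Delta$ with $g(a_k)=g(b_k)=0$, $1\le k\le n$. *)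

(* Defs.v *)
From HB Require Import structures.
From mathcomp Require Import all_boot all_order all_algebra.
From mathcomp Require Import all_classical all_reals all_analysis.
From mathcomp Require Import complex.

Set Implicit Arguments.
Unset Strict Implicit.
Unset Printing Implicit Defensive.

Import Order.TTheory GRing.Theory Num.Theory.
Import numFieldNormedType.Exports.

Local Open Scope classical_set_scope.
Local Open Scope ring_scope.

Definition cexp (R : realType) (z : R[i]) : R[i] :=
  Complex (expR (complex.Re z) * cos (complex.Im z))
          (expR (complex.Re z) * sin (complex.Im z)).

Definition cintegral (d : measure_display) (T : measurableType d)
    (R : realType) (mu : {measure set T -> \bar R}) (f : T -> R[i]) : R[i] :=
  Complex (\int[mu]_x complex.Re (f x)) (\int[mu]_x complex.Im (f x)).

Definition mutually_independent (d : measure_display) (S : measurableType d)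
    (R : realType) (P : probability S R) (m : nat) (Y : 'I_m -> S -> R) : Prop :=
  forall B : 'I_m -> set R, (forall i, measurable (B i)) ->
    P (\bigcap_(i in [set: 'I_m]) (Y i @^-1` B i))
    = (\prod_(i < m) P (Y i @^-1` B i))%E.

(* The time index ranges over all of R; only times t >= 0 are constrained. *)
Record levy_process (d : measure_display) (S : measurableType d)
    (R : realType) (P : probability S R) (X : R -> {RV P >-> R}) : Prop := {
  levy_start : {ae P, forall w, X 0 w = 0};
  levy_independent_increments :
    forall (m : nat) (t : nat -> R), 0 <= t 0%N ->
      (forall i, (i < m)%N -> t i < t i.+1) ->
      mutually_independent P (fun (i : 'I_m) w => X (t i.+1) w - X (t i) w);
  levy_stationary_increments :
    forall (s t : R) (B : set R), 0 <= s -> s < t -> measurable B ->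
      P ((fun w => X t w - X s w) @^-1` B) = P (X (t - s) @^-1` B);
  levy_cadlag :
    {ae P, forall w,
      (forall t : R, 0 <= t -> X s w @[s --> t^'+] --> X t w) /\
      (forall t : R, 0 < t -> cvg (X s w @[s --> t^'-]))}
}.

Definition levy_exponent (R : realType) (A gamma : R)
    (nu : {measure set (measurableTypeR R) -> \bar R}) (z : R) : R[i] :=
  (A / 2 * z ^+ 2)%:C%C - 'i%C * (gamma * z)%:C%C
  - cintegral nu (fun x : R =>
      cexp ('i%C * (x * z)%:C%C) - 1
      - 'i%C * (x * z * (`|x| < 1)%R%:R)%:C%C).

Record has_triplet (d : measure_display) (S : measurableType d)
    (R : realType) (P : probability S R) (X : R -> {RV P >-> R})
    (A gamma : R) (nu : {measure set (measurableTypeR R) -> \bar R}) : Prop := {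
  triplet_gaussian_ge0 : 0 <= A;
  triplet_no_mass0 : nu [set 0] = 0%E;
  triplet_levy_measure : (\int[nu]_x (Num.min 1 (x ^+ 2))%:E < +oo)%E;
  triplet_char_fun : forall (t z : R), 0 <= t ->
    cintegral P (fun w => cexp ('i%C * (z * X t w)%:C%C))
    = cexp (- (t%:C%C * levy_exponent A gamma nu z))
}.

Definition type_Ic (R : realType) (A : R)
    (nu : {measure set (measurableTypeR R) -> \bar R}) : Prop :=
  [/\ A = 0, (nu setT < +oo)%E & forall x : R, nu [set x] = 0%E].

Definition total_mass (R : realType)
    (nu : {measure set (measurableTypeR R) -> \bar R}) : R := fine (nu setT).

Definition Delta (R : realType) (n : nat) (a b : 'I_n -> R) : set R :=
  \bigcup_(k in [set: 'I_n]) [set` `[a k, b k]].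

(* An element of D_Delta is represented by any f : R -> R whose restriction to
   Delta is continuous; two such functions agreeing on Delta are the same
   element, so every identity in D_Delta below is asserted on Delta only. *)
Definition D_ (R : realType) (Dl : set R) : set (R -> R) :=
  [set f | {within Dl, continuous f}].

(* The norms are extended-real suprema, so that unbounded means +oo. *)
Definition supnorm (R : realType) (Dl : set R) (f : R -> R) : \bar R :=
  ereal_sup [set (`|f x|)%:E | x in Dl].

Definition opnorm (R : realType) (Dl : set R) (U : (R -> R) -> R -> R) : \bar R :=
  ereal_sup [set supnorm Dl (U f) | f in
    [set f | D_ Dl f /\ (supnorm Dl f <= 1)%E]].

Record operator_on (R : realType) (Dl : set R) (U : (R -> R) -> R -> R) : Prop := {
  operator_maps : forall f, D_ Dl f -> D_ Dl (U f);
  operator_restr : forall f g, D_ Dl f -> D_ Dl g ->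
    {in Dl, f =1 g} -> {in Dl, U f =1 U g};
  operator_linear : forall (c : R) f g, D_ Dl f -> D_ Dl g ->
    {in Dl, U (fun x => c * f x + g x) =1 (fun x => c * U f x + U g x)}
}.

Definition bounded_operator (R : realType) (Dl : set R)
    (U : (R -> R) -> R -> R) : Prop :=
  operator_on Dl U /\ (opnorm Dl U < +oo)%E.

Definition truncT (R : realType)
    (nu : {measure set (measurableTypeR R) -> \bar R}) (Dl : set R)
    (f : R -> R) (x : R) : R :=
  \int[nu]_(u in [set u | Dl (x + u)]) f (x + u).

Definition truncL (R : realType)
    (nu : {measure set (measurableTypeR R) -> \bar R}) (Dl : set R)
    (f : R -> R) (x : R) : R :=
  - total_mass nu * f x + truncT nu Dl f x.

Definition is_inverse (R : realType) (Dl : set R)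
    (U V : (R -> R) -> R -> R) : Prop :=
  [/\ bounded_operator Dl U, bounded_operator Dl V,
      forall f, D_ Dl f -> {in Dl, V (U f) =1 f} &
      forall f, D_ Dl f -> {in Dl, U (V f) =1 f}].

Definition quasi_potential (R : realType)
    (nu : {measure set (measurableTypeR R) -> \bar R})
    (n : nat) (a b : 'I_n -> R) (B : (R -> R) -> R -> R) : Prop :=
  operator_on (Delta a b) B /\
  forall g, D_ (Delta a b) g -> (forall k, g (a k) = 0 /\ g (b k) = 0) ->
    {in Delta a b, (fun x => - B (truncL nu (Delta a b) g) x) =1 g}.

(* f |-> \int_Dl f(y) d_y Phi(x, y) *)
Definition stieltjes_op (R : realType) (Dl : set R) (Phi : R -> cumulative R R)
    (f : R -> R) (x : R) : R :=
  \int[lebesgue_stieltjes_measure (Phi x)]_(y in Dl) f y.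

(* Main.v *)
Require Import Defs.
From HB Require Import structures.
From mathcomp Require Import all_boot all_order all_algebra.
From mathcomp Require Import all_classical all_reals all_analysis.
From mathcomp Require Import complex measurable_realfun ring lra.
Import Order.TTheory GRing.Theory Num.Theory.
Import numFieldNormedType.Exports.
Local Open Scope classical_set_scope.
Local Open Scope ring_scope.

(** The inverse of the truncated generator is obtained as a Neumann series, with
    the operators realised as kernels, that is, families of measures.

    Let k_x(B) = c * nu ((B :&: Delta) - x), where c = 1 / Omega: the law of one
    jump from x, killed when it lands outside Delta (killed_shift).
    Writing K f (x) for the integral of f against k_x, one has T = Omega K, hence
    L = - Omega (I - K) on D_Delta.  For x in Delta the total mass of k_x is
    T 1 (x) / Omega, and ||T|| < Omega bounds it by some r < 1; since k_x does
    not charge the complement of Delta, the powers of k decrease geometrically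
    and the potential kernel mu = k + k^2 + k^3 + ... has finite mass.  Put
    Phi(x, y) = mu_x(]-oo, y]); then mu_x is the Stieltjes measure of Phi(x, .),
    and T1 f (x) is the integral U f (x) of f against mu_x.

    Algebra.  The definition of mu gives U = K + K U (potential_renewal), i.e.
    (I - K) (I + U) = I.  As K contracts the sup norm on Delta, I - K is injective,
    which turns this right inverse into a two-sided one (potential_renewalC).

    Continuity.  Because nu has no atoms, dominated convergence makes K h
    continuous as soon as h, cut off outside Delta, has finitely many
    discontinuities (continuous_killed_shift): cutting off a continuous
    function creates jumps at the a_k and b_k only, and the indicator of
    ]-oo, y] adds one at y.  The partial sums of the Neumann series of such an h
    are therefore continuous, and they converge to U h uniformly on Delta at
    rate r^n (neumann_sum_approx).  With h in D_Delta this shows that T1 acts in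
    D_Delta; with h the indicator of ]-oo, y] it is the continuity of Phi(., y).
    Continuity of Phi(x, .) says that mu_x has no atoms, which it inherits from
    nu. *)

Set Implicit Arguments.
Unset Strict Implicit.
Unset Printing Implicit Defensive.

(** * Potential of a sub-probability kernel *)

Section potential.
Context d (T : measurableType d) (R : realType) (k : R.-spker T ~> T).
Local Open Scope ereal_scope.

(** The indexing is shifted: [kpow m] is the power of exponent m + 1, because the
    potential does not include the identity. *)
Fixpoint kpow (m : nat) : R.-spker T ~> T :=
  if m is m'.+1 then mkcomp_noparam k (kpow m') else k.

Definition potential : T -> {measure set T -> \bar R} :=
  kseries (fun m => kpow m : R.-ker T ~> T).

Lemma ge0_integral_kpowS m (f : T -> \bar R) x :
  (forall y, 0 <= f y) -> measurable_fun [set: T] f ->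
  integral (kpow m.+1 x) setT f = \int[k x]_y integral (kpow m y) setT f.
Proof.
move=> f0 mf.
exact: (@integral_kcomp _ _ _ T T T R k (kernel.kernel_snd (kpow m))).
Qed.

(** Splitting off the first term of the series and factoring k out of the others. *)
Lemma ge0_integral_potential (f : T -> \bar R) x :
  (forall y, 0 <= f y) -> measurable_fun [set: T] f ->
  \int[potential x]_y f y =
  \int[k x]_y f y + \int[k x]_y \int[potential y]_z f z.
Proof.
move=> f0 mf; rewrite [LHS]integral_kseries//.
have int0 n y : 0 <= \int[kpow n y]_z f z by exact: integral_ge0.
rewrite (nneseries_split _ 1)//; last by move=> n _; exact: int0.
rewrite big_mkord big_ord_recl big_ord0 addr0; congr (_ + _).
rewrite add0n -nneseries_addn//.
transitivity (\sum_(i <oo) \int[k x]_y \int[kpow i y]_z f z).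
  by apply: eq_eseriesr => i _; rewrite addn1 ge0_integral_kpowS.
rewrite -integral_nneseries//; last first.
  move=> n; apply: measurable_fun_integral_kernel => // U.
  exact: measurable_kernel.
by apply: eq_integral => y _; rewrite integral_kseries.
by move=> i; exact: int0.
Qed.

Lemma potential_null B : measurable B -> (forall x, k x B = 0) ->
  forall x, potential x B = 0.
Proof.
move=> mB kB x; rewrite /potential /= /mseries eseries0// => m _ _ /=.
elim: m x => [|m IH] x //=.
by rewrite /kcomp_noparam integral0_eq.
Qed.

(** The first step of the chain leads into D, where each further step loses a
    factor r; so the mass of the power of exponent m + 1 is at most r^m from any
    starting point, inside D or not. *)
Lemma potential_setT_le (D : set T) (r : R) : measurable D ->
    (0 < r < 1)%R -> (forall x, k x (~` D) = 0) ->
    (forall x, D x -> k x setT <= r%:E) ->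
  forall x, potential x setT <= ((1 - r)^-1)%:E.
Proof.
move=> mD /andP[r0 r1] kC kD x.
have kpowS m c y : (0 <= c)%R -> (forall z, D z -> kpow m z setT <= c%:E) ->
    kpow m.+1 y setT <= c%:E * k y setT.
  move=> c0 kc; rewrite /= /kcomp_noparam.
  have mk : measurable_fun [set: T] (fun z => kpow m z setT).
    exact: measurable_kernel.
  rewrite (ge0_negligible_integral (measurableC mD))// ?setTD ?setCK//.
  apply: (@le_trans _ _ (\int[k y]_(z in D) c%:E)).
    apply: ge0_le_integral => //; first exact: measurable_funTS.
  rewrite integral_cst// lee_wpmul2l ?lee_fin// le_measure ?inE//.
have powD m z : D z -> kpow m z setT <= (r ^+ m.+1)%:E.
  elim: m z => [|m IH] z Dz; first by rewrite expr1 kD.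
  apply: (le_trans (kpowS m (r ^+ m.+1)%R z _ IH)); first exact/exprn_ge0/ltW.
  by rewrite [in leRHS]exprSr EFinM lee_wpmul2l ?kD// lee_fin exprn_ge0 ?ltW.
have powT m : kpow m x setT <= (r ^+ m)%:E.
  case: m => [|m]; first by rewrite expr0 sprob_kernel_le1.
  apply: (le_trans (kpowS m (r ^+ m.+1)%R x _ (powD m))).
    exact/exprn_ge0/ltW.
  by rewrite -[leRHS]mule1 lee_wpmul2l ?sprob_kernel_le1// lee_fin exprn_ge0 ?ltW.
rewrite /potential/= /mseries; apply: lime_le.
  by apply: is_cvg_nneseries.
apply: nearW => n; apply: (@le_trans _ _ (\sum_(0 <= i < n) (r ^+ i)%:E)).
  by apply: lee_sum => i _.
rewrite sumEFin lee_fin -[leRHS]mul1r.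
apply: le_trans (@geometric_le_lim R n 1 r _ r0 _) => //; last first.
  by rewrite gtr0_norm.
by rewrite /series/= ler_sum// => i _; rewrite mul1r.
Qed.

End potential.

(** * Integration of bounded measurable functions *)

Section bounded_measurable.
Context d (T : measurableType d) (R : realType).
Implicit Types (h g : T -> R) (m : {measure set T -> \bar R}).

Definition bmeas h : Prop :=
  measurable_fun [set: T] h /\ exists M, forall x, `|h x| <= M.

Lemma bmeas_cst c : bmeas (fun=> c).
Proof. by split; [exact: measurable_cst|exists `|c|]. Qed.

Lemma bmeasD h g : bmeas h -> bmeas g -> bmeas (fun x => h x + g x).
Proof.
move=> [mh [M hM]] [mg [N gN]]; split; first exact: measurable_funD.
by exists (M + N) => x; rewrite (le_trans (ler_normD _ _))// lerD.
Qed.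

Lemma bmeasZ c h : bmeas h -> bmeas (fun x => c * h x).
Proof.
move=> [mh [M hM]]; split; first exact: measurable_funM.
by exists (`|c| * M) => x; rewrite normrM ler_wpM2l.
Qed.

Lemma bmeasB h g : bmeas h -> bmeas g -> bmeas (fun x => h x - g x).
Proof.
move=> bh /(bmeasZ (-1)) bg; have := bmeasD bh bg.
by under [X in bmeas X -> _]eq_fun do rewrite mulN1r.
Qed.

Lemma bmeas_restrict D h : measurable D -> bmeas h -> bmeas (h \_ D).
Proof.
move=> mD [mh [M hM]]; split.
  by apply/(measurable_restrictT _ mD); exact: measurable_funTS.
exists M => x; rewrite /patch; case: ifP => // _.
by rewrite normr0 (le_trans _ (hM x)).
Qed.

Lemma bmeas_integrable m h : (m setT < +oo)%E -> bmeas h ->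
  m.-integrable setT (EFin \o h).
Proof.
move=> mT [mh [M hM]]; apply: measurable_bounded_integrable => //.
exists M; split; first exact: num_real.
by move=> x Mx y _ /=; exact: le_trans (hM y) (ltW Mx).
Qed.

Lemma Rintegral_bmeasD m h g : (m setT < +oo)%E -> bmeas h -> bmeas g ->
  \int[m]_x (h x + g x) = \int[m]_x h x + \int[m]_x g x.
Proof. by move=> mT bh bg; apply: RintegralD => //; exact: bmeas_integrable. Qed.

Lemma Rintegral_bmeasZ m c h : (m setT < +oo)%E -> bmeas h ->
  \int[m]_x (c * h x) = c * \int[m]_x h x.
Proof. by move=> mT bh; apply: RintegralZl => //; exact: bmeas_integrable. Qed.

Lemma Rintegral_bmeasB m h g : (m setT < +oo)%E -> bmeas h -> bmeas g ->
  \int[m]_x (h x - g x) = \int[m]_x h x - \int[m]_x g x.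
Proof. by move=> mT bh bg; apply: RintegralB => //; exact: bmeas_integrable. Qed.

Lemma Rintegral_bmeas_restrict m D h : (m setT < +oo)%E -> measurable D ->
  m (~` D) = 0%E -> bmeas h -> \int[m]_x h x = \int[m]_x (h \_ D) x.
Proof.
move=> mT mD mC bh; rewrite -Rintegral_mkcond /Rintegral; congr fine.
rewrite (negligible_integral (measurableC mD))// ?setTD ?setCK//.
exact: bmeas_integrable.
Qed.

Lemma normr_Rintegral_bmeas_le m D M h : (m setT < +oo)%E -> measurable D ->
    m (~` D) = 0%E -> bmeas h -> (forall x, D x -> `|h x| <= M) -> 0 <= M ->
  `|\int[m]_x h x| <= M * fine (m setT).
Proof.
move=> mT mD mC bh hM M0; rewrite (Rintegral_bmeas_restrict mT mD mC bh).
have bhD := bmeas_restrict mD bh.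
apply: le_trans (le_normr_Rintegral measurableT (bmeas_integrable mT bhD)) _.
rewrite -Rintegral_cst//; apply: le_Rintegral => //.
- exact/integrable_norm/bmeas_integrable.
- exact: (bmeas_integrable mT (bmeas_cst M)).
- move=> x _; rewrite /patch; case: ifPn => [/set_mem/hM//|_].
  by rewrite normr0.
Qed.

Lemma bmeas_Rintegral_kernel (l : R.-ker T ~> T) C h :
  (forall x, l x setT <= C%:E)%E -> bmeas h -> bmeas (fun x => \int[l x]_y h y).
Proof.
move=> lC bh.
have [mh [M hM]] := bh.
split.
  apply: (@measurableT_comp _ _ _ _ _ _ fine) => //.
  under eq_fun do rewrite integralE.
  apply: emeasurable_funB; apply: measurable_fun_integral_kernel => //.
  - exact: measurable_kernel.
  - exact/measurable_funepos/measurable_EFinP.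
  - exact: measurable_kernel.
  - exact/measurable_funeneg/measurable_EFinP.
exists (`|M| * C) => x.
have lx : (l x setT < +oo)%E by apply: le_lt_trans (lC x) _; rewrite ltry.
apply: (@le_trans _ _ (`|M| * fine (l x setT))).
  apply: (@normr_Rintegral_bmeas_le _ setT) => //; first by rewrite setCT measure0.
  by move=> y _; rewrite (le_trans (hM y))// ler_norm.
rewrite ler_wpM2l// -lee_fin fineK// ge0_fin_numE//.
Qed.

End bounded_measurable.

(** * The Neumann series of the integral operator of a kernel *)

Section resolvent.
Context d (T : measurableType d) (R : realType) (k : R.-spker T ~> T).
Variables (D : set T) (r : R).
Hypothesis mD : measurable D.
Hypothesis r01 : 0 < r < 1.
Hypothesis kC : forall x, k x (~` D) = 0%E.
Hypothesis kD : forall x, D x -> (k x setT <= r%:E)%E.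

Local Notation K h := (fun x => \int[k x]_y h y).
Local Notation U h := (fun x => \int[potential k x]_y h y).

Lemma kernel_finite x : (k x setT < +oo)%E.
Proof. by apply: le_lt_trans (sprob_kernel_le1 k x) _; rewrite ltry. Qed.

Lemma potential_finite x : (potential k x setT < +oo)%E.
Proof. by apply: le_lt_trans (potential_setT_le mD r01 kC kD x) _; rewrite ltry. Qed.

Lemma bmeas_kernel h : bmeas h -> bmeas (K h).
Proof. by apply: bmeas_Rintegral_kernel => x; exact: sprob_kernel_le1. Qed.

Lemma bmeas_potential h : bmeas h -> bmeas (U h).
Proof.
apply: (@bmeas_Rintegral_kernel _ _ _ (potential k) (1 - r)^-1).
exact: (potential_setT_le mD).
Qed.

(** The nonnegative case is transferred to h by adding to h a constant that
    bounds it, and subtracting the identity for that constant. *)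
Lemma potential_renewal h x : bmeas h -> U h x = K h x + K (U h) x.
Proof.
move=> bh.
have ge0 g : bmeas g -> (forall y, 0 <= g y) -> U g x = K g x + K (U g) x.
  move=> bg g0; have [mg _] := bg.
  rewrite [LHS]/Rintegral ge0_integral_potential//; last first.
    exact/measurable_EFinP.
  have fin_int y : (\int[potential k y]_z (g z)%:E)%E \is a fin_num.
    exact: (integrable_fin_num measurableT (bmeas_integrable (potential_finite y) bg)).
  rewrite fineD.
  - congr (_ + _); rewrite /Rintegral; congr fine.
    by apply: eq_integral => y _; rewrite fineK.
  - exact: (integrable_fin_num measurableT (bmeas_integrable (kernel_finite x) bg)).
  - under eq_integral do rewrite -(fineK (fin_int _)).
    apply: (integrable_fin_num measurableT).
    exact: (bmeas_integrable (kernel_finite x) (bmeas_potential bg)).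
have [_ [M hM]] := bh.
have bM := bmeas_cst T M.
have bhM := bmeasD bh bM.
have M0 : 0 <= M by exact: le_trans (hM x).
have hM0 y : 0 <= h y + M by rewrite -lerBlDr sub0r lerNnormlW.
have := ge0 _ bhM hM0.
have UhM y : U (fun y => h y + M) y = U h y + U (fun=> M) y.
  by rewrite Rintegral_bmeasD//; exact: potential_finite.
have -> : K (U (fun y => h y + M)) x = K (U h) x + K (U (fun=> M)) x.
  rewrite -(Rintegral_bmeasD (kernel_finite x) (bmeas_potential bh) (bmeas_potential bM)).
  by apply: eq_Rintegral => y _; exact: UhM.
rewrite (Rintegral_bmeasD (potential_finite x) bh bM).
rewrite (Rintegral_bmeasD (kernel_finite x) bh bM).
by rewrite (ge0 _ bM (fun=> M0)) addrACA => /addIr.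
Qed.

Lemma kernel_contraction M h x : bmeas h -> (forall y, D y -> `|h y| <= M) -> D x ->
  `|K h x| <= r * M.
Proof.
move=> bh hM Dx; have M0 : 0 <= M by exact: le_trans (hM x Dx).
apply: le_trans (normr_Rintegral_bmeas_le (kernel_finite x) mD (kC x) bh hM M0) _.
rewrite mulrC ler_wpM2r// -lee_fin fineK ?kD// ge0_fin_numE//.
exact: kernel_finite.
Qed.

(** Injectivity of I - K on D. *)
Lemma kernel_fixpoint_eq0 h : bmeas h -> (forall x, D x -> h x = K h x) ->
  forall x, D x -> h x = 0.
Proof.
move=> bh hK x Dx; have [_ [M hM]] := bh.
have hn n y : D y -> `|h y| <= M * r ^+ n.
  elim: n y => [|n IH] y Dy; first by rewrite expr0 mulr1.
  by rewrite hK// exprS mulrCA; exact: kernel_contraction.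
apply/eqP; rewrite -normr_le0.
have /andP[r0 r1] := r01.
have := @cvg_geometric R M r; rewrite gtr0_norm// => /(_ r1) cM.
by apply: (cvgr_to_ge cM); near=> n; exact: hn.
Unshelve. all: by end_near.
Qed.

(** The difference w of the two sides satisfies w = K w, by the renewal equation
    for h and for K h. *)
Lemma potential_renewalC h x : bmeas h -> D x ->
  U h x = K h x + U (K h) x.
Proof.
move=> bh Dx; have bK := bmeas_kernel bh.
have b0 := bmeasB (bmeas_potential bh) bK.
have bw := bmeasB b0 (bmeas_potential bK).
apply/eqP; rewrite -subr_eq0 opprD addrA; apply/eqP.
apply: (kernel_fixpoint_eq0 bw _ Dx) => y _.
rewrite (Rintegral_bmeasB (kernel_finite y) b0 (bmeas_potential bK)).
rewrite (Rintegral_bmeasB (kernel_finite y) (bmeas_potential bh) bK).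
rewrite {1}(potential_renewal y bh) {1}(potential_renewal y bK).
by rewrite /=; ring.
Qed.

(** This is K h + K^2 h + ... + K^(n+1) h in Horner form. *)
Definition neumann_sum (h : T -> R) (n : nat) : T -> R :=
  iter n (fun g x => K h x + K g x) (K h).

Lemma bmeas_neumann_sum h n : bmeas h -> bmeas (neumann_sum h n).
Proof.
move=> bh; elim: n => [|n IH]; first exact: bmeas_kernel.
exact: (bmeasD (bmeas_kernel bh) (bmeas_kernel IH)).
Qed.

(** The renewal equation shows that K maps the error at rank n to the error at
    rank n + 1. *)
Lemma neumann_sum_approx h : bmeas h ->
  exists M, forall n x, D x -> `|U h x - neumann_sum h n x| <= M * r ^+ n.
Proof.
move=> bh; have [_ [M hM]] := bmeasB (bmeas_potential bh) (bmeas_neumann_sum 0 bh).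
exists M; elim=> [|n IH] x Dx; first by rewrite expr0 mulr1.
rewrite potential_renewal// opprD addrACA subrr add0r.
rewrite -(Rintegral_bmeasB (kernel_finite x))//; last 2 first.
- exact: bmeas_potential.
- exact: bmeas_neumann_sum.
rewrite exprS mulrCA; apply: kernel_contraction => //.
exact: (bmeasB (bmeas_potential bh) (bmeas_neumann_sum n bh)).
Qed.

End resolvent.

(** * Jumps killed outside a set *)

(** Dominated convergence along sequences.  Continuity in the parameter is required
    at the single point [x0], for almost every t; this is what allows integrands
    that jump at a place depending on t. *)
Lemma continuous_Rintegral_bounded d (T : measurableType d) (R : realType)
    (m : {measure set T -> \bar R}) (F : R -> T -> R) (M x0 : R) :
    (m setT < +oo)%E -> (forall x, measurable_fun [set: T] (F x)) ->
    (forall x t, `|F x t| <= M) ->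
    {ae m, forall t, F x t @[x --> x0] --> F x0 t} ->
  (\int[m]_t F x t) @[x --> x0] --> \int[m]_t F x0 t.
Proof.
move=> mT mF FM Fx0; apply/(@cvg_nbhsP _ R^o) => w wx0.
have bF x : bmeas (F x) by split => //; exists M.
apply: fine_cvg; rewrite fineK; last first.
  exact: (integrable_fin_num measurableT (bmeas_integrable mT (bF _))).
have [] := @dominated_convergence _ _ _ m setT measurableT
  (fun n t => (F (w n) t)%:E) (fun t => (F x0 t)%:E) (fun=> M%:E) => //.
- by move=> n; exact/measurable_EFinP.
- exact/measurable_EFinP.
- apply: filterS Fx0 => t Ft _; apply: cvg_EFin; first by apply: nearW.
  exact: (cvg_comp _ _ wx0 Ft).
- exact: (bmeas_integrable mT (bmeas_cst _ M)).
- by apply: aeW => t n _; rewrite lee_fin.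
Qed.

Lemma continuous_patch (R : realType) (D : set R) (g : R -> R) (z : R) :
    closed D -> (D z -> D° z /\ {for z, continuous g}) ->
  {for z, continuous (g \_ D)}.
Proof.
move=> cD Dg; change ((g \_ D) @ z --> (g \_ D) z).
have [Dz|nDz] := pselect (D z).
  have [iDz cg] := Dg Dz.
  have -> : (g \_ D) z = g z by rewrite patchE mem_set.
  apply: cvg_trans cg.
  apply: near_eq_cvg; near=> t; rewrite patchE mem_set//.
  by near: t.
have -> : (g \_ D) z = 0 by rewrite patchE memNset.
apply: cvg_near_cst; near=> t; rewrite patchE memNset//=.
near: t; have : open (~` D) by exact: closed_openC.
by rewrite openE => /(_ _ nDz).
Unshelve. all: by end_near.
Qed.

Section killed_shift.
Context (R : realType).
Local Notation TR := (measurableTypeR R).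
Variables (nu : {measure set TR -> \bar R}) (c : {nonneg R}) (D : set TR).
Hypothesis mD : measurable D.

Definition translate (x : R) : TR -> TR := fun u : R => x + u.

Lemma measurable_translate x : measurable_fun [set: TR] (translate x).
Proof.
have : measurable_fun [set: R] (fun u : R => x + u) by exact: measurable_funD.
exact.
Qed.

Lemma measurable_translate_preimage x (B : set TR) : measurable B ->
  measurable (translate x @^-1` B).
Proof. by move=> mB; rewrite -[X in measurable X]setTI; exact: measurable_translate. Qed.

HB.instance Definition _ x :=
  isMeasurableFun.Build _ _ _ _ (translate x) (measurable_translate x).

(** A name for the push-forward, to which a measure structure can be attached once
    the measurability of the translation is supplied. *)
Definition translated (x : TR) : set TR -> \bar R := pushforward nu (translate x).

HB.instance Definition _ (x : TR) := Measure.copy (translated x)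
  (measure_function_pushforward__canonical__measure_function_Measure nu
     (measurable_translate x)).

Definition killed_shift (x : TR) : {measure set TR -> \bar R} :=
  mscale c (mrestr (translated x) mD).

Lemma killed_shiftE x B :
  killed_shift x B = (c%:num%:E * nu (translate x @^-1` (B `&` D)))%E.
Proof. by []. Qed.

Hypothesis nuT : (nu setT < +oo)%E.
Hypothesis cnu : (c%:num%:E * nu setT <= 1)%E.

Lemma measurable_killed_shift B : measurable B ->
  measurable_fun [set: TR] (killed_shift ^~ B).
Proof.
move=> mB.
pose add2 (p : TR * TR) : TR := (p.1 : R) + p.2.
have madd2 : measurable_fun [set: TR * TR] add2.
  have : measurable_fun [set: TR * TR] (fun p : TR * TR => (p.1 : R) + p.2).
    by apply: measurable_funD; [exact: measurable_fst|exact: measurable_snd].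
  exact.
have mA : measurable (add2 @^-1` (B `&` D)).
  by rewrite -[X in measurable X]setTI; apply: madd2 => //; exact: measurableI.
apply: measurable_funeM.
have := measurable_fun_xsection (mfrestr measurableT nuT) mA.
congr measurable_fun; apply/funext => x /=.
rewrite /mfrestr /mrestr setIT; congr (nu _).
by apply/seteqP; split => u; rewrite /xsection/= inE.
Qed.

HB.instance Definition _ :=
  isKernel.Build _ _ TR TR R killed_shift measurable_killed_shift.

Lemma killed_shift_le1 x : (killed_shift x setT <= 1)%E.
Proof.
apply: le_trans cnu; rewrite killed_shiftE lee_wpmul2l// le_measure ?inE//.
by apply: measurable_translate_preimage; exact: measurableI.
Qed.

Let killed_shift_sup : (ereal_sup [set killed_shift x setT | x in setT] <= 1)%E.
Proof. by apply/ge_ereal_sup => _ [x _ <-]; exact: killed_shift_le1. Qed.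

HB.instance Definition _ :=
  Kernel_isSubProbability.Build _ _ TR TR R killed_shift killed_shift_sup.

(** The kernel structure of [killed_shift] rests on the hypotheses on nu and c; here
    they become explicit arguments. *)
Definition killed_kernel : R.-spker TR ~> TR := killed_shift.

Lemma killed_shiftC x : killed_shift x (~` D) = 0%E.
Proof. by rewrite killed_shiftE setICl preimage_set0 measure0 mule0. Qed.

Lemma ge0_integral_killed_shift x (f : TR -> \bar R) :
  (forall y, 0 <= f y)%E -> measurable_fun [set: TR] f ->
  (\int[killed_shift x]_y f y =
   c%:num%:E * \int[nu]_(u in translate x @^-1` D) f (translate x u))%E.
Proof.
move=> f0 mf.
rewrite ge0_integral_mscale//; congr (_ * _)%E.
rewrite (ge0_negligible_integral (measurableC mD))//; last first.
  by rewrite /= /mrestr setICl measure0.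
rewrite setTD setCK.
rewrite (@eq_measure_integral _ _ _ D (translated x)).
  rewrite ge0_integral_pushforward//.
  exact: measurable_funTS.
by move=> A mA AD /=; rewrite /mrestr setIidl.
Qed.

Lemma Rintegral_killed_shift x (h : TR -> R) : bmeas h ->
  \int[killed_shift x]_y h y =
  c%:num * \int[nu]_(u in translate x @^-1` D) h (translate x u).
Proof.
move=> bh; have [mh _] := bh.
have mxD : measurable (translate x @^-1` D) by exact: measurable_translate_preimage.
have mhx : measurable_fun [set: TR] (h \o translate x).
  exact: measurableT_comp.
have ih : nu.-integrable (translate x @^-1` D) (EFin \o (h \o translate x)).
  apply: (integrableS measurableT) => //; apply: bmeas_integrable => //.
  by split => //; have [_ [M hM]] := bh; exists M => y; exact: hM.
rewrite /Rintegral integralE !ge0_integral_killed_shift//; last 2 first.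
- exact/measurable_funeneg/measurable_EFinP.
- exact/measurable_funepos/measurable_EFinP.
have iE : (\int[nu]_(u in translate x @^-1` D) (h (translate x u))%:E =
    \int[nu]_(u in translate x @^-1` D) (fun y => (h y)%:E)^\+ (translate x u) -
    \int[nu]_(u in translate x @^-1` D) (fun y => (h y)%:E)^\- (translate x u))%E.
  by rewrite (integralE _ _ ((EFin \o h) \o translate x)) funepos_comp funeneg_comp.
rewrite -muleBr//.
  rewrite -iE fineM//; exact: integrable_fin_num ih.
have := integrable_neg_fin_num mxD ih.
rewrite (_ : EFin \o _ = (EFin \o h) \o translate x)// funeneg_comp => fn.
by rewrite fin_num_adde_defl// fin_numN.
Qed.

Lemma Rintegral_killed_shift_patch x (h : TR -> R) : bmeas h ->
  \int[killed_shift x]_y h y = c%:num * \int[nu]_u (h \_ D) (x + u).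
Proof.
by move=> bh; rewrite Rintegral_killed_shift// Rintegral_mkcond.
Qed.

Hypothesis nu1 : forall x : R, nu [set x] = 0%E.

(** This is where the absence of atoms of nu enters the continuity of K h. *)
Lemma ae_translate_notin (s : seq R) (x : R) :
  {ae nu, forall u : TR, x + (u : R) \notin s}.
Proof.
elim: s => [|e s IH]; first exact: aeW.
have ne : {ae nu, forall u : TR, x + (u : R) <> e}.
  exists [set (e - x)]; split => //.
  by move=> u /= /contrapT <-; rewrite addrC addKr.
apply: filterS2 IH ne => u us ue.
by rewrite inE negb_or us andbT; apply/eqP.
Qed.

Variable s : seq R.

(** For fixed x0 the integrand u |-> (h \_ D) (x + u) fails to be continuous at
    x = x0 only when x0 + u is in [s], an event of nu-measure zero. *)
Lemma continuous_killed_shift (h : TR -> R) : bmeas h ->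
  (forall z, z \notin s -> {for z, continuous (h \_ D : R -> R)}) ->
  continuous (fun x : R => \int[killed_shift x]_y h y).
Proof.
move=> bh hs x0.
have bhD := bmeas_restrict mD bh.
have [mhD [M hM]] := bhD.
rewrite /continuous_at.
under [X in X @ _ --> _]eq_fun do rewrite Rintegral_killed_shift_patch//.
rewrite Rintegral_killed_shift_patch//.
apply: (@cvgMr _ _ _ _ (fun x : R => \int[nu]_u (h \_ D) (x + u))).
apply: (@continuous_Rintegral_bounded _ _ _ nu (fun x u => (h \_ D) (x + u)) M) => //.
  by move=> x; apply: (measurableT_comp mhD); exact: measurable_translate.
apply: filterS (ae_translate_notin s x0) => u us.
apply: (@continuous_comp _ _ _ (fun x : R => x + u) (h \_ D : R -> R)).
  by apply: cvgD; [exact: cvg_id|exact: cvg_cst].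
exact: hs.
Qed.

Lemma continuous_neumann_sum (h : TR -> R) :
    closed (D : set R) -> (forall z : R, z \notin s -> D z -> (D : set R)° z) ->
    bmeas h -> (forall z, z \notin s -> {for z, continuous (h \_ D : R -> R)}) ->
  forall n, continuous (neumann_sum killed_kernel h n : R -> R).
Proof.
move=> cD sD bh hs; elim=> [|n IH]; first exact: continuous_killed_shift.
have bS := bmeas_neumann_sum killed_kernel n bh.
have cKS : continuous (fun x : R =>
    \int[killed_shift x]_y neumann_sum killed_kernel h n y).
  apply: continuous_killed_shift => // z zs; apply: continuous_patch => // Dz.
  by split; [exact: sD|exact: IH].
move=> x; apply: (@continuousD _ _ _ (fun x : R => \int[killed_shift x]_y h y) _ x).
  exact: continuous_killed_shift.
exact: cKS.
Qed.

End killed_shift.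

(** Uniform limit of continuous functions: the error is at most M r^n on D. *)
Lemma within_continuous_potential (R : realType)
    (k : R.-spker (measurableTypeR R) ~> (measurableTypeR R))
    (D : set (measurableTypeR R)) (r : R) (h : measurableTypeR R -> R) :
    measurable D -> 0 < r < 1 -> (forall x, k x (~` D) = 0%E) ->
    (forall x, D x -> (k x setT <= r%:E)%E) -> bmeas h ->
    (forall n, continuous (neumann_sum k h n : R -> R)) ->
  {within (D : set R), continuous (fun x : R => \int[potential k x]_y h y)}.
Proof.
move=> mD r01 kC kD bh cS.
have [M hM] := neumann_sum_approx mD r01 kC kD bh.
apply/subspace_continuousP => x Dx; apply/cvgrPdist_lt => e e0.
rewrite /from_subspace.
have /andP[r0 r1] := r01.
have := @cvg_geometric R M r; rewrite gtr0_norm// => /(_ r1) cM.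
have e3 : 0 < e / 3 by rewrite divr_gt0.
have [n Mn] : exists n, M * r ^+ n < e / 3.
  near \oo => n; exists n; near: n.
  exact: (cvgr_lt _ cM).
have := cS n x => /cvgrPdist_lt /(_ _ e3) near_x.
near=> y.
have Dy : D y by near: y; exact: withinT.
have Sxy : `|neumann_sum k h n x - neumann_sum k h n y| < e / 3.
  by near: y; apply: cvg_within.
have Ux := le_lt_trans (hM n x Dx) Mn.
have Uy := le_lt_trans (hM n y Dy) Mn.
move: Ux Uy Sxy.
move: (neumann_sum k h n x) (neumann_sum k h n y) => p q.
move: (\int[potential k x]_z h z) (\int[potential k y]_z h z) => a b.
by rewrite !ltr_norml => /andP[? ?] /andP[? ?] /andP[? ?]; apply/andP; lra.
Unshelve. all: by end_near.
Qed.

(** * Distribution functions of finite measures without atoms *)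

Lemma lebesgue_stieltjes_measureE (R : realType) (F : cumulative R R)
    (m : {measure set (measurableTypeR R) -> \bar R}) :
  (forall y : R, (F y)%:E = m (`]-oo, y]%classic : set R)) ->
  forall A : set (measurableTypeR R), measurable A ->
    lebesgue_stieltjes_measure F A = m A.
Proof.
move=> FE; apply: lebesgue_stieltjes_measure_unique => _ [[a b]/= _ <-].
rewrite /lebesgue_stieltjes_measure /measure_extension/=.
rewrite measurable_mu_extE/=; last exact: is_ocitv.
have [ab | ba] := leP a b; last first.
  by rewrite set_itv_ge ?wlength0 ?measure0// bnd_simp -leNgt ltW.
rewrite wlength_itv_bnd// EFinB !FE.
have -> : `]a, b]%classic = `]-oo, b] `\` `]-oo, a].
  by rewrite -[RHS]setCK setCD setCitvl setUC -[LHS]setCK setCitv.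
rewrite measureD.
- by rewrite setIidr//; exact: subset_itvl.
- exact: (@measurable_itv R).
- exact: (@measurable_itv R).
- by have := ltry (F b); rewrite FE.
Qed.

Lemma bmeas_indic_Ny (R : realType) (y : R) :
  bmeas (\1_(`]-oo, y]%classic : set R) : measurableTypeR R -> R).
Proof.
split.
  have mI : measurable (`]-oo, y]%classic : set (measurableTypeR R)).
    exact: (@measurable_itv R).
  exact: (measurable_indic mI).
by exists 1 => t; rewrite indicE; case: (_ \in _); rewrite /= ?normr1 ?normr0.
Qed.

Lemma cvg_indic_Ny (R : realType) (y t : R) : t <> y ->
  \1_(`]-oo, x]%classic : set R) t @[x --> y] --> (\1_(`]-oo, y]%classic : set R) t : R).
Proof.
move=> /eqP; rewrite neq_lt => /orP[ty|yt].
  rewrite [X in _ --> X]indicE mem_set/=; last by rewrite in_itv/= ltW.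
  apply: cvg_near_cst; near=> x; rewrite indicE mem_set//= in_itv/= ltW//.
  by near: x; exact: lt_nbhsr.
rewrite [X in _ --> X]indicE memNset/=; last first.
  by rewrite in_itv/=; apply/negP; rewrite -ltNge.
apply: cvg_near_cst; near=> x; rewrite indicE memNset//= in_itv/=.
apply/negP; rewrite -ltNge.
by near: x; exact: lt_nbhsl.
Unshelve. all: by end_near.
Qed.

Lemma continuous_indic_Ny (R : realType) (y t : R) : t <> y ->
  {for t, continuous (\1_(`]-oo, y]%classic : set R) : R -> R)}.
Proof.
move=> /eqP; rewrite neq_lt => /orP[ty|yt];
  change ((\1_(`]-oo, y]%classic : set R) : R -> R) @ t -->
          (\1_(`]-oo, y]%classic : set R) t : R)).
  rewrite [X in _ --> X]indicE mem_set/=; last by rewrite in_itv/= ltW.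
  apply: cvg_near_cst; near=> x; rewrite indicE mem_set//= in_itv/= ltW//.
  by near: x; exact: lt_nbhsl.
rewrite [X in _ --> X]indicE memNset/=; last first.
  by rewrite in_itv/=; apply/negP; rewrite -ltNge.
apply: cvg_near_cst; near=> x; rewrite indicE memNset//= in_itv/=.
apply/negP; rewrite -ltNge.
by near: x; exact: lt_nbhsr.
Unshelve. all: by end_near.
Qed.

Lemma exists_cumulative (R : realType)
    (m : {measure set (measurableTypeR R) -> \bar R}) :
    (m setT < +oo)%E -> (forall x : R, m [set x] = 0%E) ->
  exists F : cumulative R R,
    [/\ forall y : R, F y = \int[m]_t (\1_(`]-oo, y]%classic : set R) t),
        continuous F &
        forall A : set (measurableTypeR R), measurable A ->
          lebesgue_stieltjes_measure F A = m A].
Proof.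
move=> mT m1.
pose f (y : R) : R := \int[m]_t (\1_(`]-oo, y]%classic : set R) t).
have bI (y : R) := bmeas_indic_Ny y.
have fE (y : R) : (f y)%:E = m (`]-oo, y]%classic : set R).
  rewrite /f /Rintegral fineK; last first.
    exact: (integrable_fin_num measurableT (bmeas_integrable mT (bI y))).
  by rewrite integral_indic// setIT.
have fc : continuous f.
  move=> y; apply: (@continuous_Rintegral_bounded _ _ _ m _ 1) => //.
  - by move=> x; have [] := bI x.
  - by move=> x t; rewrite indicE; case: (_ \in _); rewrite /= ?normr1 ?normr0.
  exists [set y]; split => //.
  move=> t /=; apply: contra_notP => ty; exact: cvg_indic_Ny.
have fnd : nondecreasing f.
  move=> x y xy; rewrite -lee_fin !fE le_measure ?inE//.
  by move=> t /=; rewrite !in_itv/= => /le_trans; exact.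
have frc : right_continuous f.
  by move=> x; apply: cvg_within_filter; exact: fc.
pose F : cumulative R R := HB.pack f (isCumulative.Build R _ R f fnd frc).
exists F; split => //.
exact: lebesgue_stieltjes_measureE.
Unshelve. all: by end_near.
Qed.

(** * Integral operators on D_Delta *)

Section D_Delta.
Context (R : realType).
Local Notation TR := (measurableTypeR R).
Variable D : set R.
Hypothesis cptD : compact D.

Lemma compact_measurableTR : measurable (D : set TR).
Proof. exact: (@compact_measurable R). Qed.

Let mD := compact_measurableTR.

Lemma bmeas_D_ f : D_ D f -> bmeas (f \_ D : TR -> R).
Proof.
move=> cf; split.
  apply/(measurable_restrictT _ mD).
  exact: (@subspace_continuous_measurable_fun R D f mD cf).
have /compact_bounded[M [_ hM]] := continuous_compact cf cptD.
exists (`|M| + 1) => x; rewrite patchE; case: ifPn => [/set_mem Dx|_].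
  by apply: (hM (`|M| + 1)) => /=; [rewrite ltr_pwDr// ler_norm|exists x].
by rewrite normr0 addr_ge0.
Qed.

Lemma supnorm_le f M : (supnorm D f <= M%:E)%E <-> forall x, D x -> `|f x| <= M.
Proof.
split=> [fM x Dx|fM].
  rewrite -lee_fin; apply: le_trans fM; apply: ereal_sup_ubound.
  by exists x.
by apply: ge_ereal_sup => _ [x Dx <-]; rewrite lee_fin fM.
Qed.

(** The truncated generator, its inverse, B and T1 all have this form, with the
    kernel k or its potential. *)
Lemma bounded_operator_kernel (l : TR -> {measure set TR -> \bar R})
    (al be C : R) (V : (R -> R) -> R -> R) :
    (forall x, l x setT <= C%:E)%E ->
    (forall f, D_ D f -> {within D, continuous (fun x : R => \int[l x]_y (f \_ D) y)}) ->
    (forall f x, D_ D f -> D x -> V f x = al * f x + be * \int[l x]_y (f \_ D) y) ->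
  bounded_operator D V.
Proof.
move=> lC lc VE.
have lfin x : (l x setT < +oo)%E by apply: le_lt_trans (lC x) _; rewrite ltry.
split; last first.
  apply: (@le_lt_trans _ _ (`|al| + `|be| * C)%:E); last by rewrite ltry.
  apply: ge_ereal_sup => _ [f [cf f1] <-]; apply/supnorm_le => x Dx.
  have {}f1 := (supnorm_le f 1).1 f1.
  rewrite VE// (le_trans (ler_normD _ _))// !normrM lerD//.
    by rewrite ler_piMr// f1.
  rewrite ler_wpM2l//.
  apply: (@le_trans _ _ (1 * fine (l x setT))).
    apply: (@normr_Rintegral_bmeas_le _ _ _ _ setT) => //.
    - by rewrite setCT measure0.
    - exact: bmeas_D_.
    - move=> y _; rewrite patchE; case: ifPn => [/set_mem/f1//|_].
      by rewrite normr0.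
  by rewrite mul1r -lee_fin fineK// ge0_fin_numE.
split.
- move=> f cf.
  apply: (@subspace_eq_continuous _ _ _
    (fun x => al * f x + be * \int[l x]_y (f \_ D) y)).
    by move=> x /set_mem Dx; apply/esym/VE.
  move=> x; apply: cvgD.
    by apply: cvgMr; exact: cf.
  by apply: cvgMr; exact: (lc f cf).
- move=> f g cf cg fg x /set_mem Dx; rewrite !VE// fg ?inE//.
  congr (_ + _ * _); apply: eq_Rintegral => y _.
  by rewrite !patchE; case: ifPn => // /fg.
- move=> c f g cf cg x /set_mem Dx.
  have cfg : D_ D (fun x => c * f x + g x).
    move=> y; apply: cvgD; last exact: cg.
    by apply: cvgMr; exact: cf.
  rewrite !VE//.
  have -> : \int[l x]_y ((fun x => c * f x + g x) \_ D) y =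
      c * \int[l x]_y (f \_ D) y + \int[l x]_y (g \_ D) y.
    rewrite -Rintegral_bmeasZ//; last exact: bmeas_D_.
    rewrite -Rintegral_bmeasD//; last exact: bmeas_D_.
      apply: eq_Rintegral => y _; rewrite !patchE.
      by case: ifPn => // _; rewrite mulr0 addr0.
    by apply: bmeasZ; exact: bmeas_D_.
  by ring.
Qed.

End D_Delta.

(** * The set Delta *)

Section Delta_geometry.
Context (R : realType) (n : nat) (a b : 'I_n -> R).

Lemma compact_Delta : compact (Delta a b).
Proof.
have -> : Delta a b = \big[setU/set0]_(k < n) `[a k, b k]%classic.
  apply/seteqP; split => x.
    by move=> [k _ xk]; rewrite -bigcup_seq; exists k => //=; rewrite mem_index_enum.
  by rewrite -bigcup_seq => -[k _ xk]; exists k.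
by apply: bigsetU_compact => k _; exact: segment_compact.
Qed.

Definition endpoints : seq R := codom a ++ codom b.

Lemma interior_Delta x : x \notin endpoints -> Delta a b x -> (Delta a b)° x.
Proof.
rewrite mem_cat negb_or => /andP[xa xb] [k _ /=]; rewrite in_itv/= => /andP[ax bx].
have ax' : a k < x.
  by rewrite lt_neqAle ax andbT; apply: contra xa => /eqP <-; exact: codom_f.
have bx' : x < b k.
  by rewrite lt_neqAle bx andbT; apply: contra xb => /eqP ->; exact: codom_f.
have : \forall y \near x, y \in `]a k, b k[.
  by apply: near_in_itvoo; rewrite in_itv/= ax' bx'.
apply: filterS => y /=; rewrite in_itv/= => /andP[? ?].
by exists k => //=; rewrite in_itv/= !ltW.
Qed.

End Delta_geometry.

(** * The truncated generator *)

Lemma truncT_killed_shift (R : realType)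
    (nu : {measure set (measurableTypeR R) -> \bar R}) (D : set R)
    (mD : measurable (D : set (measurableTypeR R))) (c : {nonneg R})
    (f : R -> R) (x : R) :
  (nu setT < +oo)%E ->
  bmeas (f \_ D : measurableTypeR R -> R) ->
  \int[killed_shift nu c mD x]_y (f \_ D) y = c%:num * truncT nu D f x.
Proof.
move=> nuT bf; rewrite (Rintegral_killed_shift c mD nuT)//; congr (_ * _).
by apply: eq_Rintegral => u /set_mem Du; rewrite patchE mem_set.
Qed.

(** The operator norm bounds T 1, and T 1 (x) is the mass of the jumps from x that
    land in D. *)
Lemma opnorm_truncT_contraction (R : realType)
    (nu : {measure set (measurableTypeR R) -> \bar R}) (D : set R) :
    measurable (D : set (measurableTypeR R)) -> D !=set0 ->
    (nu setT < +oo)%E -> (opnorm D (truncT nu D) < (total_mass nu)%:E)%E ->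
  exists2 q : R, 0 <= q < total_mass nu &
    forall x, D x -> fine (nu (translate x @^-1` D)) <= q.
Proof.
move=> mD [x0 Dx0] nuT nT.
have c1 : D_ D (cst 1 : R -> R) by move=> x; exact: cvg_cst.
have Tq x : D x -> ((fine (nu (translate x @^-1` D)))%:E <= opnorm D (truncT nu D))%E.
  move=> Dx; apply: (@le_trans _ _ (supnorm D (truncT nu D (cst 1)))).
    apply: ereal_sup_ubound; exists x => //; congr (_%:E).
    rewrite /truncT Rintegral_cst ?mul1r; last exact: measurable_translate_preimage.
    by rewrite ger0_norm; [exact: erefl | apply: fine_ge0; exact: measure_ge0].
  apply: ereal_sup_ubound; exists (cst 1) => //; split => //.
  by apply/supnorm_le => y _; rewrite normr1.
have q0 : (0 <= opnorm D (truncT nu D))%E.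
  by apply: le_trans (Tq x0 Dx0); rewrite lee_fin fine_ge0.
have qfin : opnorm D (truncT nu D) \is a fin_num.
  by rewrite ge0_fin_numE// (lt_trans nT)// ltry.
exists (fine (opnorm D (truncT nu D))).
  by rewrite -lee_fin -lte_fin fineK// q0.
by move=> x Dx; rewrite -lee_fin [leRHS]fineK//; exact: Tq.
Qed.

Theorem theorem2p5 (R : realType) (d : measure_display) (S : measurableType d)
    (P : probability S R) (X : R -> {RV P >-> R})
    (A gamma : R) (nu : {measure set (measurableTypeR R) -> \bar R})
    (n : nat) (a b : 'I_n -> R)
    (n_gt0 : (0 < n)%N)
    (ltab : forall k, a k < b k)
    (ltba : forall j k : 'I_n, (j < k)%N -> b j < a k)
    (levyX : levy_process X)
    (tripletX : has_triplet X A gamma nu)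
    (IcX : type_Ic A nu)
    (gammaE : gamma = \int[nu]_(y in [set y : R | `|y| < 1]) y)
    (normT : (opnorm (Delta a b) (truncT nu (Delta a b))
              < (total_mass nu)%:E)%E) :
  exists Phi : R -> cumulative R R,
    let T1 := stieltjes_op (Delta a b) Phi in
    let B := fun (f : R -> R) (x : R) =>
      (total_mass nu)^-1 * (f x + T1 f x) in
    [/\ is_inverse (Delta a b) (truncL nu (Delta a b)) (fun f x => - B f x),
        quasi_potential nu a b B,
        bounded_operator (Delta a b) T1,
        (forall y : R, {within Delta a b, continuous (fun x => Phi x y)}) &
        (forall x : R, x \in Delta a b ->
           continuous (Phi x) /\ {homo Phi x : y z / y <= z})].
Proof.
have [_ nuT nu1] := IcX.
have cptD := @compact_Delta R n a b.
have mD := compact_measurableTR cptD.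
have D0 : Delta a b !=set0.
  exists (a (Ordinal n_gt0)); exists (Ordinal n_gt0) => //=.
  by rewrite in_itv/= lexx ltW.
have [q /andP[q0 q1] nuq] := opnorm_truncT_contraction mD D0 nuT normT.
have intD := @interior_Delta R n a b.
rewrite /quasi_potential; set D := Delta a b in cptD mD D0 nuq intD normT *.
set s := endpoints a b in intD.
set Om := total_mass nu in q1 *.
have Om0 : 0 < Om by exact: le_lt_trans q1.
have OmE : Om%:E = nu setT by rewrite fineK// ge0_fin_numE.
have c0 : 0 <= Om^-1 by rewrite invr_ge0 ltW.
pose c : {nonneg R} := NngNum c0.
have cnu : (c%:num%:E * nu setT <= 1)%E.
  by rewrite -OmE -EFinM/= mulVf ?gt_eqF.
pose k := killed_kernel mD nuT cnu.
pose mu := potential k.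
(* The midpoint of q / Om and 1 is used instead of q / Om itself, since q may be
   0 while the geometric bounds ask for r > 0. *)
pose r := (q / Om + 1) / 2.
have qOm1 : q / Om < 1 by rewrite ltr_pdivrMr// mul1r.
have qOm0 : 0 <= q / Om by rewrite divr_ge0// ltW.
have r01 : 0 < r < 1 by rewrite /r; lra.
have kC x : k x (~` D) = 0%E by exact: killed_shiftC.
have kD x : D x -> (k x setT <= r%:E)%E.
  move=> Dx; rewrite [k x setT]killed_shiftE setTI.
  rewrite -[nu _]fineK; last first.
    rewrite ge0_fin_numE//; apply: (le_lt_trans _ nuT).
    by rewrite le_measure ?inE//; exact: measurable_translate_preimage.
  rewrite -EFinM lee_fin /= (@le_trans _ _ (q / Om))//.
    by rewrite mulrC ler_wpM2r// nuq.
  by rewrite /r; lra.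
have mufin x := potential_finite mD r01 kC kD x.
have muC x : mu x (~` D) = 0%E by apply: (potential_null _ kC); exact: measurableC.
have mu1 x (y : R) : mu x [set y] = 0%E.
  apply: potential_null => // z.
  rewrite killed_shiftE (_ : nu _ = 0%E) ?mule0//.
  apply/eqP; rewrite -measure_le0 -(nu1 (y - z)) le_measure ?inE//.
    apply: measurable_translate_preimage; exact: measurableI.
  by move=> u [/= <- _]; rewrite /translate addrC addKr.
have muT x := potential_setT_le mD r01 kC kD x.
have /choice[Phi PhiP] : forall x : R, exists F : cumulative R R,
    [/\ forall y : R, F y = \int[mu x]_t (\1_(`]-oo, y]%classic : set R) t),
        continuous F &
        forall A : set (measurableTypeR R), measurable A ->
          lebesgue_stieltjes_measure F A = mu x A].
  by move=> x; exact: (exists_cumulative (mufin x) (mu1 x)).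
exists Phi; set T1 := stieltjes_op D Phi; set B := fun f x => _ * (_ + T1 f x).
have bD f : D_ D f -> bmeas (f \_ D : measurableTypeR R -> R) by exact: bmeas_D_.
have T1E f x : T1 f x = \int[mu x]_y (f \_ D) y.
  have [_ _ PhiE] := PhiP x.
  rewrite -Rintegral_mkcond /T1 /stieltjes_op /Rintegral; congr fine.
  by apply: eq_measure_integral => E mE _; exact: PhiE.
have TE f x : D_ D f -> truncT nu D f x = Om * \int[k x]_y (f \_ D) y.
  move=> cf; rewrite (truncT_killed_shift _ _ _ nuT (bD f cf))//=.
  by rewrite mulrA mulfV ?mul1r// gt_eqF.
have cD : closed D by exact: (compact_closed (@Rhausdorff R)).
have patch_cont f z : D_ D f -> z \notin s -> {for z, continuous (f \_ D)}.
  move=> cf zs; apply: continuous_patch => // Dz; split; first exact: intD.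
  have /subspace_continuousP/(_ z Dz) := cf.
  by rewrite within_interior//; exact: intD.
have patch_patch (f : R -> R) : (f \_ D) \_ D = f \_ D.
  by apply/funext => x; rewrite !patchE; case: (x \in D).
have cont_k f : D_ D f -> continuous (fun x : R => \int[k x]_y (f \_ D) y).
  move=> cf; apply: (continuous_killed_shift nuT nu1 (s := s)).
    exact: bD.
  by move=> z zs; rewrite patch_patch; exact: patch_cont.
have cont_mu f : D_ D f ->
    {within D, continuous (fun x : R => \int[mu x]_y (f \_ D) y)}.
  move=> cf; apply: (within_continuous_potential mD r01 kC kD (bD f cf)).
  apply: (continuous_neumann_sum nu1 cD intD (bD f cf)) => z zs.
  by rewrite patch_patch; exact: patch_cont.
have LE f x : D_ D f -> truncL nu D f x = - Om * f x + Om * \int[k x]_y (f \_ D) y.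
  by move=> cf; rewrite /truncL TE.
have bopL : bounded_operator D (truncL nu D).
  apply: (@bounded_operator_kernel _ D cptD k (- Om) Om 1) => //.
  - by move=> x; exact: sprob_kernel_le1.
  - by move=> f cf; apply: continuous_subspaceT; exact: cont_k.
  - by move=> f x cf _; exact: LE.
have bopT1 : bounded_operator D T1.
  apply: (@bounded_operator_kernel _ D cptD mu 0 1 (1 - r)^-1) => //.
  by move=> f x cf _; rewrite mul0r add0r mul1r.
have bopB : bounded_operator D B.
  apply: (@bounded_operator_kernel _ D cptD mu Om^-1 Om^-1 (1 - r)^-1) => //.
  by move=> f x cf _; rewrite /B T1E mulrDr.
have bopNB : bounded_operator D (fun f x => - B f x).
  apply: (@bounded_operator_kernel _ D cptD mu (- Om^-1) (- Om^-1) (1 - r)^-1) => //.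
  by move=> f x cf _; rewrite /B T1E mulrDr opprD !mulNr.
have DB f : D_ D f -> D_ D (fun x => - B f x).
  by case: bopNB => /operator_maps DB _; exact: DB.
have BL f : D_ D f -> {in D, (fun x => - B (truncL nu D f) x) =1 f}.
  move=> cf x /set_mem Dx.
  have bf := bD f cf; have bK := bmeas_kernel k bf; have bKD := bmeas_restrict mD bK.
  (* U (L f) is expanded by linearity; the cut-off of K f is harmless because mu x
     does not charge the complement of D. *)
  have LfE : truncL nu D f \_ D =
      (fun y => Om * ((fun z => \int[k z]_y (f \_ D) y) \_ D) y + - Om * (f \_ D) y).
    apply/funext => y; rewrite !patchE; case: ifP => _; last first.
      by rewrite !mulr0 addr0.
    by rewrite LE// addrC.
  rewrite /B T1E LfE Rintegral_bmeasD//; last 2 first.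
  - exact: bmeasZ.
  - exact: bmeasZ.
  rewrite !Rintegral_bmeasZ//.
  rewrite -(Rintegral_bmeas_restrict _ mD (muC x) bK)//.
  rewrite (potential_renewalC mD r01 kC kD bf Dx) LE//.
  rewrite -/mu; field.
  by rewrite gt_eqF.
have LB f : D_ D f -> {in D, truncL nu D (fun x => - B f x) =1 f}.
  move=> cf x /set_mem Dx.
  have bf := bD f cf; have bU := bmeas_potential mD r01 kC kD bf.
  have bUD := bmeas_restrict mD bU.
  rewrite LE; last exact: DB.
  have -> : (fun x => - B f x) \_ D = (fun y => - Om^-1 * (f \_ D) y +
      - Om^-1 * ((fun z => \int[mu z]_y (f \_ D) y) \_ D) y).
    apply/funext => y; rewrite !patchE; case: ifP => _; last first.
      by rewrite !mulr0 addr0.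
    by rewrite /B T1E mulrDr opprD !mulNr.
  have kfin := kernel_finite k x.
  rewrite Rintegral_bmeasD//; last 2 first.
  - exact: bmeasZ.
  - exact: bmeasZ.
  rewrite !Rintegral_bmeasZ//.
  rewrite -(Rintegral_bmeas_restrict kfin mD (kC x) bU)//.
  rewrite /B T1E (potential_renewal mD r01 kC kD x bf).
  rewrite -/mu; field.
  by rewrite gt_eqF.
split.
- by split.
- by split; [case: bopB|move=> g cg _; exact: BL].
- exact: bopT1.
- move=> y.
  have PhiE : (fun x => Phi x y) =
      (fun x => \int[mu x]_t (\1_(`]-oo, y]%classic : set R) t)).
    by apply/funext => x; have [] := PhiP x.
  rewrite PhiE.
  have bI : bmeas (\1_(`]-oo, y]%classic : set R) : measurableTypeR R -> R).
    exact: bmeas_indic_Ny.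
  apply: (within_continuous_potential mD r01 kC kD bI).
  apply: (continuous_neumann_sum nu1 (s := y :: s) cD _ bI) => z.
    by rewrite inE negb_or => /andP[_]; exact: intD.
  rewrite inE negb_or => /andP[zy zs].
  apply: continuous_patch => // Dz; split; first exact: intD.
  by apply: continuous_indic_Ny; exact/eqP.
- move=> x _; have [_ cPhi _] := PhiP x; split => //.
  exact: cumulative_is_nondecreasing.
Qed.
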